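(* Let $p$ be an odd prime. (i) If $p\equiv1\pmod{3}$, then $$\sum_{k=0}^{p-1}\frac{9k+2}{108^k}\binom{2k}{k}^2\binom{3k}{k}\equiv0\pmod{p^2}.$$ (ii) If $p\equiv1$ or $3\pmod{8}$, then $$\sum_{k=0}^{p-1}\frac{16k+3}{256^k}\binom{2k}{k}^2\binom{4k}{2k}\equiv0\pmod{p^{2+\delta_{p,3}}}.$$ (iii) If $p\equiv1\pmod{4}$, then $$\sum_{k=0}^{p-1}\frac{4k+1}{64^k}\binom{2k}{k}^3\equiv0\pmod{p^2}$$ and $$\sum_{k=0}^{p-1}\frac{36k+5}{12^{3k}}\binom{6k}{3k}\binom{3k}{k}\binom{2k}{k}\equiv0\pmod{p^{2+\delta_{p,5}}}.$$
   Context: $\delta_{p,q}$ is the Kronecker delta, equal to $1$ if $p=q$ and $0$ otherwise. The congruences between rational numbers are understood in the ring $\mathbb{Z}_p$ of $p$-adic integers (the sums are $p$-adic integers). *)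

(* Defs.v *)
From mathcomp Require Import all_boot all_order all_algebra.

Set Implicit Arguments.
Unset Strict Implicit.
Unset Printing Implicit Defensive.

Import GRing.Theory.
Local Open Scope ring_scope.

(* The rationals that are p-adic integers, i.e. the elements of
   Q ∩ Z_p = Z_(p): denq x is the denominator of x in lowest terms. *)
Definition p_integral (p : nat) (x : rat) : Prop :=
  ~~ (p%:Z %| denq x)%Z.

(* Congruence modulo p ^ r in Z_p, between rational numbers lying in Z_p.
   The quotient (x - y) / p ^ r is rational, so asking for it in Z_p is the
   same as asking for it in Z_(p). *)
Definition padic_congr (p r : nat) (x y : rat) : Prop :=
  [/\ p_integral p x, p_integral p y &
      exists2 z : rat, p_integral p z & x - y = p%:R ^+ r * z].

(* Main.v *)
Require Import Defs.
From HB Require Import structures.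
From mathcomp Require Import all_boot all_order all_algebra.
From mathcomp Require Import ring zify.

Import Order.TTheory GRing.Theory Num.Theory.
Local Open Scope ring_scope.

(** With x = - a and u = x (x + 1) = - a (1 - a), the four sums are, up to the
    factor 1 / a ^ 2 with a = 1/3, 1/4, 1/2, 1/6, the values at x of one family
    of polynomials,
      S_p(x) = sum_(k < p) c_k (k - u) e_k(x),
      c_k = (1/2)_k / k! ^ 3,   e_k(x) = (- x)_k (1 + x)_k.
    The point is to find two roots of S_p that are p-adically close to x.

    Since (k - u) e_k = e_(k+1) - k ^ 2 e_k, the sum S_p is, up to a multiple
    of e_p, half of G_p(x) = sum_(j < p) c_j / (j + 1) e_(j+1)(x), which is
    - x (x + 1) times a truncated 3F2(1/2, 1 - x, 2 + x; 1, 2; 1).  At an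
    integer x = n >= 0 this is a terminating case of Watson's summation, which
    vanishes when n is even.  The vanishing is proved by creative telescoping:
    (x + 1) ^ 2 G_N(x + 2) - (x + 2) ^ 2 G_N(x) is an explicit multiple of
    e_N(x + 1) ([watson_rec]), and e_N kills the integers 0, ..., N - 1.  Hence
    S_p(n) = 0 for every even n < p ([wsum_even_eq0]).

    Moreover S_p depends on u alone, so S_p(- 1 - x) = S_p(x).  As p is odd,
    p - 1 - n is even together with n, and so n - p = - 1 - (p - 1 - n) is a
    second root.  The coefficients of S_p lie in Z_(p), so dividing by the
    monic factors gives S_p(x) = (x - n) (x - n + p) q with q in Z_(p)
    ([wsum_factor]).

    Finally let x = - 1 / m and let n be its residue modulo p, say
    m n + 1 = r p.  Then x - n = - r p / m and x - n + p = (m - r) p / m, which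
    gives the factor p ^ 2, and one more p when p divides r ([wsum_congr]).
    The congruence conditions on p say that n is even; for m = 4, p = 3 and
    for m = 6, p = 5 one has r = p, whence the stronger moduli. *)

(** * The Pochhammer products and their coefficients *)

(** The product (- x)_k (1 + x)_k.  It is needed both for rational x and for
    the polynomial variable, hence the generic ring. *)
Definition poch {R : comPzRingType} (k : nat) (x : R) : R :=
  \prod_(j < k) ((j%:R - x) * (j.+1%:R + x)).

Lemma pochS {R : comPzRingType} k (x : R) :
  poch k.+1 x = poch k x * ((k%:R - x) * (k.+1%:R + x)).
Proof. by rewrite /poch big_ord_recr. Qed.

Lemma poch_reflect {R : comPzRingType} k (x : R) :
  poch k (- 1 - x) = poch k x.
Proof. by apply: eq_bigr => j _; ring. Qed.

Lemma poch_eq0 {R : comPzRingType} k (n : nat) :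
  (n < k)%N -> poch k (n%:R : R) = 0.
Proof. by move=> nk; rewrite /poch (bigD1 (Ordinal nk)) //= subrr !mul0r. Qed.

(** This shift and the next one compare the products at x and at x + 2 with a
    common one at x + 1, so that the recurrence [watson_rec] needs no
    division by quantities depending on x. *)
Lemma poch_shift1 {R : comPzRingType} k (x : R) :
  poch k.+1 x = - ((k%:R - 1 - x) * (k%:R - x)) * poch k (x + 1).
Proof.
elim: k => [|k IH]; first by rewrite pochS /poch !big_ord0; ring.
by rewrite pochS IH pochS; ring.
Qed.

Lemma poch_shift2 {R : comPzRingType} k (x : R) :
  poch k.+1 (x + 2) = - ((x + 2 + k%:R) * (x + 3 + k%:R)) * poch k (x + 1).
Proof.
elim: k => [|k IH]; first by rewrite pochS /poch !big_ord0; ring.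
by rewrite pochS IH pochS; ring.
Qed.

Lemma horner_poch k (x : rat) : (poch k 'X).[x] = poch k x.
Proof.
rewrite /poch horner_prod; apply: eq_bigr => j _.
by rewrite !hornerE -!polyC_natr !hornerC.
Qed.

Lemma natr_fact_neq0 n : n`!%:R != 0 :> rat.
Proof. by rewrite pnatr_eq0 -lt0n fact_gt0. Qed.

Lemma natr_bin m n : 'C(m + n, n)%:R = (m + n)`!%:R / (n`!%:R * m`!%:R) :> rat.
Proof.
rewrite -(@bin_fact (m + n) n) ?leq_addl // addnK !natrM.
by rewrite mulfK // mulf_neq0 ?natr_fact_neq0.
Qed.

(** This is (1/2)_k / k! ^ 3. *)
Definition hcoef (k : nat) : rat := 'C(2 * k, k)%:R / (4 ^+ k * k`!%:R ^+ 2).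

Lemma hcoefS k : k.+1%:R ^+ 3 * hcoef k.+1 = (k%:R + 1 / 2) * hcoef k.
Proof.
rewrite /hcoef !mul2n -!addnn !natr_bin.
have -> : (k.+1 + k.+1 = (k + k).+2)%N by rewrite addnS.
rewrite !factS !natrM [4 ^+ _]exprS.
have k0 := natr_fact_neq0 k.
have k1 : 1 + k%:R != 0 :> rat by rewrite nat1r pnatr_eq0.
have x4 : (4 : rat) ^+ k != 0 by rewrite expf_neq0.
by field; rewrite k0 x4 k1.
Qed.

(** * The weighted sum and its integer roots *)

(** The sum is kept as a polynomial in x so that it can be factored. *)
Definition wsum (N : nat) : {poly rat} :=
  \sum_(k < N) hcoef k *: ((k%:R - 'X * ('X + 1)) * poch k 'X).

Lemma horner_wsum N x :
  (wsum N).[x] = \sum_(k < N) hcoef k * ((k%:R - x * (x + 1)) * poch k x).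
Proof.
rewrite /wsum horner_sum; apply: eq_bigr => k _.
by rewrite hornerZ hornerM horner_poch !hornerE -polyC_natr hornerC.
Qed.

(** Both the weight and the Pochhammer products depend on x (x + 1) only. *)
Lemma wsum_reflect N x : (wsum N).[- 1 - x] = (wsum N).[x].
Proof.
rewrite !horner_wsum; apply: eq_bigr => k _; rewrite poch_reflect; ring.
Qed.

(** Up to the factor - x (x + 1), the truncation of
    3F2(1/2, 1 - x, 2 + x; 1, 2; 1). *)
Definition watson (N : nat) (x : rat) : rat :=
  \sum_(j < N) hcoef j / j.+1%:R * poch j.+1 x.

(** Abel summation: (k - x (x + 1)) e_k = e_(k+1) - k ^ 2 e_k, and
    k ^ 2 c_k = c_(k-1) (1 - 1 / (2 k)), so that after regrouping by e_k only
    half of c_(k-1) / k survives. *)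
Lemma wsum_watson N x :
  (wsum N.+1).[x] = watson N x / 2 + hcoef N * poch N.+1 x.
Proof.
elim: N => [|N IH].
  rewrite horner_wsum /watson big_ord_recr !big_ord0 pochS /poch big_ord0 /=.
  by ring.
rewrite horner_wsum big_ord_recr /= -horner_wsum IH /watson big_ord_recr /=.
have k1 : 1 + N%:R != 0 :> rat by rewrite nat1r pnatr_eq0.
have k2 := hcoefS N.
have -> : hcoef N = N.+1%:R ^+ 3 * hcoef N.+1 / (N%:R + 1 / 2).
  rewrite k2 mulrAC mulfV ?mul1r //.
  by rewrite lt0r_neq0 // ltr_wpDl.
have h : N%:R * 2 + 1 != 0 :> rat by rewrite lt0r_neq0 // ltr_wpDl // mulr_ge0.
by rewrite (pochS N.+1); field; rewrite k1 h.
Qed.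

(** The recurrence of Zeilberger's algorithm, in the form that holds for
    truncated sums: the right-hand side is the antidifference in N of the
    summand on the left, so that each induction step is one rational identity. *)
Lemma watson_rec N x :
  (x + 1) ^+ 2 * watson N (x + 2) - (x + 2) ^+ 2 * watson N x =
  2 * (2 * x + 3) * N%:R ^+ 2 * hcoef N * poch N (x + 1).
Proof.
elim: N => [|N IH]; first by rewrite /watson !big_ord0; ring.
rewrite /watson !big_ord_recr /= -!/(watson _ _).
rewrite poch_shift2 (poch_shift1 _ x) pochS.
have k1 : 1 + N%:R != 0 :> rat by rewrite nat1r pnatr_eq0.
have -> : hcoef N.+1 = (N%:R + 1 / 2) * hcoef N / N.+1%:R ^+ 3.
  by rewrite -hcoefS mulrAC mulfV ?mul1r ?expf_neq0 ?pnatr_eq0.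
have split a b : (x + 1) ^+ 2 * (watson N (x + 2) + a)
    - (x + 2) ^+ 2 * (watson N x + b) = ((x + 1) ^+ 2 * watson N (x + 2)
    - (x + 2) ^+ 2 * watson N x) + ((x + 1) ^+ 2 * a - (x + 2) ^+ 2 * b).
  by ring.
by rewrite split IH; field.
Qed.

(** Two steps of x keep the parity of n, and the boundary term of the
    recurrence vanishes at n + 1 < N; the value at 0 is trivially 0. *)
Lemma watson_even_eq0 m N : (m.*2 < N)%N -> watson N m.*2%:R = 0.
Proof.
elim: m N => [|m IH] N mN.
  rewrite /watson big1 // => j _; by rewrite poch_eq0 ?mulr0.
have /eqP := watson_rec N m.*2%:R.
have -> : m.*2%:R + 1 = m.*2.+1%:R :> rat by rewrite -natr1.
rewrite IH; last by lia.
rewrite poch_eq0; last by lia.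
rewrite !mulr0 subr0 mulf_eq0 expf_eq0 pnatr_eq0 /= => /eqP.
by rewrite doubleS -[m.*2.+2]addn2 natrD.
Qed.

(** The bound on n also kills the boundary term of [wsum_watson]. *)
Lemma wsum_even_eq0 m N : (m.*2 < N)%N -> (wsum N).[m.*2%:R] = 0.
Proof.
case: N => // N mN; rewrite wsum_watson.
have : watson N.+1 m.*2%:R = 0 by exact: watson_even_eq0.
rewrite /watson big_ord_recr /= poch_eq0 // !mulr0 !addr0 => ->.
by rewrite mul0r.
Qed.

(** * The localization of the integers at p *)

(** A boolean predicate carrying the proof that p is prime, so that the
    subring structure can be inferred from it. *)
Definition Zloc {p : nat} (p_prime : prime p) : {pred rat} :=
  fun x => ~~ (p%:Z %| denq x)%Z.

(** Denominators prime to p need not be in lowest terms, which makes closure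
    under the ring operations immediate. *)
Lemma ZlocP {p : nat} (p_prime : prime p) (x : rat) :
  reflect (exists2 d : nat, ~~ (p %| d)%N & exists m : int, x * d%:R = m%:~R)
          (x \in Zloc p_prime).
Proof.
apply: (iffP idP) => [px | [d pd [m xd]]].
  exists `|denq x|%N; first by move: px; rewrite /Zloc unfold_in dvdzE.
  by exists (numq x); rewrite pmulrn absz_denq -numqE.
rewrite unfold_in dvdzE /=; apply: contra pd => pden.
have num_ndvd : ~~ (p %| `|numq x|)%N.
  apply: contraL (coprime_num_den x) => pnum.
  apply: contraL (prime_gt1 p_prime) => /eqP gcd1.
  by rewrite -leqNgt dvdn_leq // -gcd1 dvdn_gcd pnum.
have eqz : numq x * d%:Z = m * denq x.
  apply: (@intr_inj rat); rewrite !intrM -xd numqE -pmulrn; ring.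
have : (p %| `|numq x| * d)%N.
  by rewrite -[d in (_ * d)%N]/(`|d%:Z|%N) -abszM eqz abszM dvdn_mull.
by rewrite Euclid_dvdM // (negbTE num_ndvd).
Qed.

Lemma Zloc_subring {p : nat} (p_prime : prime p) :
  subring_closed (Zloc p_prime).
Proof.
have ndvdM d e : ~~ (p %| d)%N -> ~~ (p %| e)%N -> ~~ (p %| d * e)%N.
  by rewrite Euclid_dvdM // negb_or => -> ->.
split=> [|x y /ZlocP[d pd [m xd]] /ZlocP[e pe [n ye]]|
         x y /ZlocP[d pd [m xd]] /ZlocP[e pe [n ye]]].
- apply/ZlocP; exists 1%N; last by exists 1; rewrite mulr1.
  by rewrite dvdn1 neq_ltn prime_gt1 ?orbT.
- apply/ZlocP; exists (d * e)%N; first exact: ndvdM.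
  exists (m * e%:Z - n * d%:Z).
  by rewrite intrB !intrM -xd -ye natrM -!pmulrn; ring.
- apply/ZlocP; exists (d * e)%N; first exact: ndvdM.
  by exists (m * n); rewrite intrM -xd -ye natrM; ring.
Qed.

HB.instance Definition _ (p : nat) (p_prime : prime p) :=
  GRing.isSubringClosed.Build rat (Zloc p_prime) (Zloc_subring p_prime).

Lemma Zloc_natV {p : nat} (p_prime : prime p) (d : nat) :
  ~~ (p %| d)%N -> d%:R^-1 \in Zloc p_prime.
Proof.
move=> pd; apply/ZlocP; exists d => //; exists 1.
by rewrite mulVf // pnatr_eq0; apply: contraNneq pd => ->; rewrite dvdn0.
Qed.

(** The divisor is monic, so the quotient inherits its coefficients from S:
    it is the divided difference of f at 'X and a. *)
Lemma polyOver_root {R : comNzRingType} (S : subringClosed R)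
    (f : {poly R}) (a : R) :
  f \is a polyOver S -> a \in S -> f.[a] = 0 ->
  exists2 g : {poly R}, g \is a polyOver S & f = ('X - a%:P) * g.
Proof.
move=> fS aS fa0.
exists (\sum_(i < size f) f`_i *: \sum_(j < i) 'X^(i.-1 - j) * (a ^+ j)%:P).
  apply: rpred_sum => i _; rewrite polyOverZ ?(polyOverP fS) //.
  apply: rpred_sum => j _; rewrite rpredM ?rpredX ?polyOverX //.
  by rewrite polyOverC rpredX.
(* Subtract f.[a] = 0 coefficientwise; subrXX then divides each term. *)
have fE : f = \sum_(i < size f) f`_i *: ('X^i - (a ^+ i)%:P).
  under eq_bigr do
    rewrite scalerBr -mul_polyC -[_ *: (_ ^+ _)%:P]mul_polyC -polyCM.
  rewrite sumrB -(rmorph_sum polyC) /= -horner_coef fa0 subr0.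
  rewrite -[LHS]coefK poly_def.
  by under [RHS]eq_bigr do rewrite mul_polyC.
rewrite {1}fE mulr_sumr; apply: eq_bigr => i _.
rewrite -scalerAr rmorphXn subrXX.
by under [in RHS]eq_bigr do rewrite rmorphXn.
Qed.

(** Factoring instead of expanding f around a gives the two small factors at
    once, without any estimate of a derivative. *)
Lemma polyOver_root2 {R : idomainType} (S : subringClosed R)
    (f : {poly R}) (a b x : R) :
    f \is a polyOver S -> a \in S -> b \in S -> x \in S -> a != b ->
    f.[a] = 0 -> f.[b] = 0 ->
  exists2 q, q \in S & f.[x] = (x - a) * (x - b) * q.
Proof.
move=> fS aS bS xS ab fa fb.
have [g gS fg] := polyOver_root S f a fS aS fa.
have gb : g.[b] = 0.
  move/eqP: fb; rewrite fg hornerM hornerXsubC mulf_eq0 subr_eq0 eq_sym.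
  by rewrite (negbTE ab) => /eqP.
have [h hS gh] := polyOver_root S g b gS bS gb.
exists h.[x]; first exact: rpred_horner.
by rewrite fg gh !hornerM !hornerXsubC mulrA.
Qed.

Lemma prime_ndvd_fact {p : nat} (p_prime : prime p) k :
  (k < p)%N -> ~~ (p %| k`!)%N.
Proof.
elim: k => [|k IH] kp; first by rewrite fact0 dvdn1 neq_ltn prime_gt1 ?orbT.
rewrite factS Euclid_dvdM // negb_or IH ?andbT 1?ltnW //.
by rewrite gtnNdvd.
Qed.

(** Truncating at k < p keeps p out of the factorials in the denominators. *)
Lemma wsum_polyOver {p : nat} (p_prime : prime p) :
  odd p -> wsum p \is a polyOver (Zloc p_prime).
Proof.
move=> p_odd.
have p4 : ~~ (p %| 4)%N.
  rewrite -[4%N]/(2 ^ 2)%N Euclid_dvdX // andbT dvdn_prime2 //.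
  by apply: contraTneq p_odd => ->.
apply: rpred_sum => k _; rewrite polyOverZ //.
  rewrite rpredM ?rpred_nat // -natrX -natrX -natrM Zloc_natV //.
  rewrite Euclid_dvdM // !Euclid_dvdX // (negbTE p4).
  by rewrite (negbTE (prime_ndvd_fact p_prime _ (ltn_ord k))).
have XS := polyOverX (Zloc p_prime).
rewrite rpredM ?rpredB ?rpredM ?rpredD ?rpred_nat ?rpred1 //.
by apply: rpred_prod => j _; rewrite rpredM ?rpredB ?rpredD ?rpred_nat.
Qed.

(** * Values of the weighted sum modulo powers of p *)

(** The two roots are n and n - p, the latter being the mirror image
    - 1 - (p - 1 - n) of an even integer in the same range. *)
Lemma wsum_factor {p : nat} (p_prime : prime p) (n : nat) (x : rat) :
    odd p -> ~~ odd n -> (n < p)%N -> x \in Zloc p_prime ->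
  exists2 q, q \in Zloc p_prime &
    (wsum p).[x] = (x - n%:R) * (x - n%:R + p%:R) * q.
Proof.
move=> p_odd n_even np xS.
have root1 (m : nat) : ~~ odd m -> (m < p)%N -> (wsum p).[m%:R] = 0.
  by move=> m_even mp; rewrite -(even_halfK m_even) wsum_even_eq0 ?even_halfK.
have refl : - 1 - (p - n.+1)%:R = n%:R - p%:R :> rat by rewrite natrB //; ring.
have [|||||//|q qS ->] := polyOver_root2 _ _ n%:R (n%:R - p%:R) x
  (wsum_polyOver p_prime p_odd).
- exact: rpred_nat.
- by rewrite rpredB ?rpred_nat.
- by [].
- by rewrite -subr_eq0 opprB addrC subrK pnatr_eq0 -lt0n prime_gt0.
- exact: root1.
- by rewrite -refl wsum_reflect root1 //; lia.
- by exists q => //; rewrite opprB addrCA [p%:R + _]addrC.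
Qed.

(** At x = - 1 / m the two factors are x - n = - r p / m and
    x - n + p = (m - r) p / m.  The linear weight in the hypothesis on t is
    m ^ 2 (k - x (x + 1)), so m ^ 2 cancels the denominators. *)
Lemma wsum_congr {p : nat} (p_prime : prime p) (m n r s : nat)
    (t : nat -> rat) :
    odd p -> (0 < m)%N -> ~~ (p %| m)%N -> ~~ odd n -> (n < p)%N ->
    (m * n + 1 = r * p)%N -> (p ^ s %| r)%N ->
    (forall k, t k = (m%:R ^+ 2 * k%:R + (m%:R - 1)) *
                     (hcoef k * poch k (- (1 / m%:R)))) ->
  padic_congr p (2 + s) (\sum_(0 <= k < p) t k) 0.
Proof.
move=> p_odd m_gt0 pm n_even np mnr /dvdnP[r' rE] tE.
have m0 : m%:R != 0 :> rat by rewrite pnatr_eq0 -lt0n.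
set x : rat := - (1 / m%:R).
have xS : x \in Zloc p_prime by rewrite /x mul1r rpredN Zloc_natV.
have [q qS Wq] := wsum_factor p_prime n x p_odd n_even np xS.
have sumE : \sum_(0 <= k < p) t k = m%:R ^+ 2 * (wsum p).[x].
  rewrite horner_wsum mulr_sumr big_mkord; apply: eq_bigr => k _.
  rewrite tE -/x /x; field; exact: m0.
have xn : x - n%:R = - (r%:R * p%:R / m%:R).
  by rewrite -natrM -mnr natrD natrM /x; field.
have zS : - (r'%:R * (m%:R - r%:R) * q) \in Zloc p_prime.
  by rewrite rpredN !rpredM ?rpredB ?rpred_nat.
have inZ y : y \in Zloc p_prime -> p_integral p y by [].
have eqz : m%:R ^+ 2 * (wsum p).[x]
    = p%:R ^+ (2 + s) * - (r'%:R * (m%:R - r%:R) * q).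
  rewrite Wq xn rE natrM natrX exprD; field; exact: m0.
rewrite sumE eqz; split.
- by apply: inZ; rewrite rpredM ?rpredX ?rpred_nat.
- exact/inZ/rpred0.
- by exists (- (r'%:R * (m%:R - r%:R) * q)); [exact: inZ|rewrite subr0].
Qed.

(** * Identification of the summands *)

Lemma hcoef_pochE k x (M b : rat) :
  M != 0 -> M ^+ k * poch k x = b * k`!%:R ^+ 2 ->
  hcoef k * poch k x = 'C(2 * k, k)%:R * b / (4 * M) ^+ k.
Proof.
move=> M0 h.
have k0 := natr_fact_neq0 k.
have x4 : (4 : rat) ^+ k != 0 by rewrite expf_neq0.
have xM : M ^+ k != 0 by rewrite expf_neq0.
have -> : b = M ^+ k * poch k x / k`!%:R ^+ 2 by rewrite h mulfK ?expf_neq0.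
rewrite /hcoef exprMn; field; by rewrite k0 x4 xM.
Qed.

(** These four identities group the factors of a factorial by residue: for
    instance (3 k)! is the product of 3 (j + 1/3), 3 (j + 2/3) and
    3 (j + 1) over j < k. *)
Lemma poch3 k : 27 ^+ k * poch k (- (1 / 3)) * k`!%:R = (3 * k)`!%:R :> rat.
Proof.
elim: k => [|k IH]; first by rewrite /poch big_ord0 mul1r.
have -> : (3 * k.+1 = (3 * k).+3)%N by rewrite mulnS.
by rewrite !factS !natrM -IH pochS exprS; field.
Qed.

Lemma poch4 k :
  64 ^+ k * poch k (- (1 / 4)) * (2 * k)`!%:R = (4 * k)`!%:R :> rat.
Proof.
elim: k => [|k IH]; first by rewrite /poch big_ord0 mul1r.
have -> : (4 * k.+1 = (4 * k).+4)%N by rewrite mulnS.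
have -> : (2 * k.+1 = (2 * k).+2)%N by rewrite mulnS.
by rewrite !factS !natrM -IH pochS exprS; field.
Qed.

Lemma poch2 k :
  16 ^+ k * poch k (- (1 / 2)) * k`!%:R ^+ 2 = (2 * k)`!%:R ^+ 2 :> rat.
Proof.
elim: k => [|k IH]; first by rewrite /poch big_ord0 mul1r.
have -> : (2 * k.+1 = (2 * k).+2)%N by rewrite mulnS.
by rewrite !factS !natrM !exprMn -IH pochS exprS; field.
Qed.

Lemma poch6 k :
  432 ^+ k * poch k (- (1 / 6)) * (3 * k)`!%:R * (2 * k)`!%:R / k`!%:R =
  (6 * k)`!%:R :> rat.
Proof.
elim: k => [|k IH]; first by rewrite /poch big_ord0 !mul1r invr1.
have -> : (6 * k.+1 = (6 * k).+2.+4)%N by rewrite mulnS.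
have -> : (2 * k.+1 = (2 * k).+2)%N by rewrite mulnS.
have -> : (3 * k.+1 = (3 * k).+3)%N by rewrite mulnS.
rewrite !factS !natrM -IH pochS exprS; field.
by rewrite natr_fact_neq0 nat1r pnatr_eq0.
Qed.

Lemma term3 k : hcoef k * poch k (- (1 / 3)) =
  'C(2 * k, k)%:R ^+ 2 * 'C(3 * k, k)%:R / 108 ^+ k.
Proof.
rewrite (@hcoef_pochE _ _ 27 ('C(2 * k, k)%:R * 'C(3 * k, k)%:R)) //.
  by rewrite -[4 * 27]natrM mulrA -expr2.
have -> : (3 * k = 2 * k + k)%N by lia.
rewrite natr_bin.
have -> : (2 * k + k = 3 * k)%N by lia.
have -> : (2 * k = k + k)%N by lia.
rewrite natr_bin -poch3; field; by rewrite !natr_fact_neq0.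
Qed.

Lemma term4 k : hcoef k * poch k (- (1 / 4)) =
  'C(2 * k, k)%:R ^+ 2 * 'C(4 * k, 2 * k)%:R / 256 ^+ k.
Proof.
rewrite (@hcoef_pochE _ _ 64 ('C(2 * k, k)%:R * 'C(4 * k, 2 * k)%:R)) //.
  by rewrite -[4 * 64]natrM mulrA -expr2.
have -> : (4 * k = 2 * k + 2 * k)%N by lia.
rewrite natr_bin.
have -> : (2 * k + 2 * k = 4 * k)%N by lia.
rewrite -poch4.
have -> : (2 * k = k + k)%N by lia.
rewrite natr_bin; field; by rewrite !natr_fact_neq0.
Qed.

Lemma term2 k : hcoef k * poch k (- (1 / 2)) =
  'C(2 * k, k)%:R ^+ 3 / 64 ^+ k.
Proof.
rewrite (@hcoef_pochE _ _ 16 ('C(2 * k, k)%:R ^+ 2)) //.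
have two_k : (2 * k = k + k)%N by lia.
have k0 := natr_fact_neq0 k.
apply: (mulIf (expf_neq0 2 k0)); rewrite poch2 two_k natr_bin -two_k.
by field.
Qed.

Lemma term6 k : hcoef k * poch k (- (1 / 6)) =
  'C(6 * k, 3 * k)%:R * 'C(3 * k, k)%:R * 'C(2 * k, k)%:R / 12 ^+ (3 * k).
Proof.
rewrite (@hcoef_pochE _ _ 432 ('C(6 * k, 3 * k)%:R * 'C(3 * k, k)%:R)) //.
  rewrite exprM (_ : 4 * 432 = 12 ^+ 3); last by ring.
  by congr (_ / _); exact: mulrC.
have -> : (6 * k = 3 * k + 3 * k)%N by lia.
rewrite natr_bin.
have -> : (3 * k + 3 * k = 6 * k)%N by lia.
have -> : 'C(3 * k, k) = 'C(2 * k + k, k) by congr binomial; lia.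
rewrite natr_bin -poch6.
have -> : (2 * k + k = 3 * k)%N by lia.
by field; rewrite !natr_fact_neq0.
Qed.

Theorem corollary2 (p : nat) (p_prime : prime p) (p_odd : odd p) :
  [/\ p = 1 %[mod 3] ->
      padic_congr p 2
        (\sum_(0 <= k < p) (9 * k%:R + 2) / 108 ^+ k
                           * 'C(2 * k, k)%:R ^+ 2 * 'C(3 * k, k)%:R)
        0,
      p = 1 %[mod 8] \/ p = 3 %[mod 8] ->
      padic_congr p (2 + (p == 3%N))
        (\sum_(0 <= k < p) (16 * k%:R + 3) / 256 ^+ k
                           * 'C(2 * k, k)%:R ^+ 2 * 'C(4 * k, 2 * k)%:R)
        0
    & p = 1 %[mod 4] ->
      padic_congr p 2
        (\sum_(0 <= k < p) (4 * k%:R + 1) / 64 ^+ k * 'C(2 * k, k)%:R ^+ 3)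
        0
      /\
      padic_congr p (2 + (p == 5%N))
        (\sum_(0 <= k < p) (36 * k%:R + 5) / 12 ^+ (3 * k)
                           * 'C(6 * k, 3 * k)%:R * 'C(3 * k, k)%:R
                           * 'C(2 * k, k)%:R)
        0].
Proof.
have p_gt1 := prime_gt1 p_prime.
have p_ndvd m : prime m -> p != m -> ~~ (p %| m)%N.
  by move=> m_prime pm; rewrite dvdn_prime2.
have p2 : ~~ (p %| 2)%N by apply: p_ndvd => //; apply: contraTneq p_odd => ->.
split.
- move=> p_mod3.
  have p3 : ~~ (p %| 3)%N.
    by apply: p_ndvd => //; apply: contra_eqN p_mod3 => /eqP->.
  apply: (wsum_congr p_prime 3 (p %/ 3)%N 1 0) => //; try lia.
  by move=> k; rewrite term3; ring.
- move=> p_mod8.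
  have p4 : ~~ (p %| 4)%N by rewrite -[4%N]/(2 * 2)%N Euclid_dvdM // negb_or p2.
  (* n is the residue of - 1 / 4 modulo p and r that of 1 / p modulo 4; the
     class of p modulo 8 decides the parity of n. *)
  have [r [n [r_n n_even np rp]]] : exists r n : nat,
    [/\ (4 * n + 1 = r * p)%N, ~~ odd n, (n < p)%N & (p = 3 -> r = 3)%N].
    case: p_mod8 => p_mod8.
      by exists 1%N, (p %/ 4)%N; split; lia.
    by exists 3%N, (3 * p %/ 4)%N; split; lia.
  apply: (wsum_congr p_prime 4 n r) => // [|k]; last by rewrite term4; ring.
  by case: eqP => [p3|_]; rewrite ?expn0 ?dvd1n // expn1 p3 rp.
- move=> p_mod4; split.
  apply: (wsum_congr p_prime 2 (p %/ 2)%N 1 0) => //; try lia.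
  by move=> k; rewrite term2; ring.
- have p3 : ~~ (p %| 3)%N.
    by apply: p_ndvd => //; apply: contra_eqN p_mod4 => /eqP->.
  have p_mod3 : ~~ (3 %| p)%N by rewrite dvdn_prime2 // eq_sym -dvdn_prime2.
  have p6 : ~~ (p %| 6)%N by rewrite -[6%N]/(2 * 3)%N Euclid_dvdM // negb_or p2.
  have [r [n [r_n n_even np rp]]] : exists r n : nat,
    [/\ (6 * n + 1 = r * p)%N, ~~ odd n, (n < p)%N & (p = 5 -> r = 5)%N].
    (* The residue 9 modulo 12 would make 3 divide p. *)
    have [p_mod|p_mod] : (p %% 12 = 1 \/ p %% 12 = 5)%N by lia.
      by exists 1%N, (p %/ 6)%N; split; lia.
    by exists 5%N, (5 * p %/ 6)%N; split; lia.
  apply: (wsum_congr p_prime 6 n r) => // [|k]; last by rewrite term6; ring.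
  by case: eqP => [p5|_]; rewrite ?expn0 ?dvd1n // expn1 p5 rp.
Qed.
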